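(* Let $H\in(0,1)$, $p>0$, and $x\in\mathfrak X^H$. Then, for all $t\in(0,1]$, $$\lim_{n\uparrow\infty}\sum_{s\in\mathbb T_n,\,s\le t}|x(s')-x(s)|^p=\begin{cases}0&\text{if }p>1/H,\\ +\infty&\text{if }p<1/H,\\ t\cdot 2^{1-1/H}\,\mathbb E[|Z_H|^p]&\text{if }p=1/H,\end{cases}$$ where $$Z_H:=\sum_{m=0}^\infty 2^{m(H-1)}Y_m$$ for an i.i.d. sequence $Y_0,Y_1,\dots$ of $\{-1,+1\}$-valued random variables with $\mathbb P[Y_n=+1]=\frac12$. In particular, for $p=1/H$, each $x\in\mathfrak X^H$ admits the continuous $p^{\text{th}}$ variation $\langle x\rangle^{(p)}_t=t\cdot 2^{1-1/H}\,\mathbb E[|Z_H|^p]$ along the sequence $(\mathbb T_n)$ of dyadic partitions.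
   Context: Faber--Schauder functions: for $t\in\mathbb R$, $e_{0,0}(t):=(\min\{t,1-t\})^+$ and $e_{m,k}(t):=2^{-m/2}e_{0,0}(2^mt-k)$ for $m\ge 1$, $k\in\mathbb Z$. For $H\in(0,1)$, the class of signed Takagi--Landsberg functions is $$\mathfrak X^H=\Big\{x\in C[0,1]\ \Big|\ x=\sum_{m=0}^\infty 2^{m(\frac12-H)}\sum_{k=0}^{2^m-1}\theta_{m,k}e_{m,k}\ \text{ for coefficients }\theta_{m,k}\in\{-1,+1\}\Big\},$$ where the series converges uniformly on $[0,1]$ for every choice of the $\theta_{m,k}$. Dyadic partitions: $\mathbb T_n:=\{k2^{-n}: k=0,\dots,2^n\}$, $n=0,1,\dots$. For $s\in\mathbb T_n$, $s'$ denotes the successor of $s$ in $\mathbb T_n$: $s'=\min\{t\in\mathbb T_n: t>s\}$ if $s<1$, and $s'=1$ if $s=1$. Continuous $p^{\text{th}}$ variation: for $p\ge 1$, a function $x\in C[0,1]$ admits the continuous $p^{\text{th}}$ variation $\langle x\rangle^{(p)}_t$ along $(\mathbb T_n)$ if for each $t\in[0,1]$ the limit $\langle x\rangle^{(p)}_t:=\lim_{n\uparrow\infty}\sum_{s\in\mathbb T_n,\,s\le t}|x(s')-x(s)|^p$ exists (as a finite number) and $t\mapsto\langle x\rangle^{(p)}_t$ is continuous. *)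

(* Defs.v *)
From HB Require Import structures.
From mathcomp Require Import all_boot all_order all_algebra.
From mathcomp Require Import finmap.
From mathcomp Require Import all_classical all_reals all_analysis.

Set Implicit Arguments.
Unset Strict Implicit.
Unset Printing Implicit Defensive.

Import Order.TTheory GRing.Theory Num.Theory.
Import numFieldNormedType.Exports.

Local Open Scope classical_set_scope.
Local Open Scope ring_scope.

Section FaberSchauder.
Context {R : realType}.

Definition e00 (t : R) : R := Num.max (Num.min t (1 - t)) 0.

(* At m = 0, k = 0 this is e00 itself. *)
Definition faber_schauder (m : nat) (k : int) (t : R) : R :=
  2 `^ (- (m%:R / 2)) * e00 (2 ^+ m * t - k%:~R).

Definition signed_takagi_partial (H : R) (theta : nat -> nat -> R) (N : nat)
    (t : R) : R :=
  \sum_(0 <= m < N) 2 `^ (m%:R * (2^-1 - H)) *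
    \sum_(0 <= k < 2 ^ m) theta m k * faber_schauder m k%:Z t.

(* Elements of C[0,1] are represented by total functions of which only the
   restriction to [0,1] matters. *)
Definition signed_takagi_landsberg (H : R) : set (R -> R) :=
  [set x : R -> R | {within `[0 : R, 1], continuous x} /\
    exists theta : nat -> nat -> R,
      (forall m k, (k < 2 ^ m)%N -> theta m k = -1 \/ theta m k = 1) /\
      {uniform `[0 : R, 1], signed_takagi_partial H theta @ \oo --> x}].

End FaberSchauder.

Section DyadicVariation.
Context {R : realType}.

Definition dyadic (n : nat) : seq R :=
  [seq k%:R * 2 ^- n | k <- iota 0 (2 ^ n).+1].

(* Every point of the partition is at most 1, and 1 belongs to it, so for s < 1
   the default value 1 does not affect the minimum. *)
Definition dyadic_succ (n : nat) (s : R) : R :=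
  if s < 1 then \big[Num.min/1]_(u <- dyadic n | s < u) u else 1.

Definition dyadic_pvar (x : R -> R) (p t : R) (n : nat) : R :=
  \sum_(s <- dyadic n | s <= t) `|x (dyadic_succ n s) - x s| `^ p.

Definition pvariation (x : R -> R) (p t : R) : R := limn (dyadic_pvar x p t).

Definition admits_continuous_pvariation (x : R -> R) (p : R) : Prop :=
  (forall t, 0 <= t <= 1 -> cvgn (dyadic_pvar x p t)) /\
  {within `[0 : R, 1], continuous (pvariation x p)}.

End DyadicVariation.

Section Rademacher.
Context {R : realType} {d : measure_display} {T : measurableType d}.
Variable P : probability T R.

Definition mutually_independent (Y : nat -> {RV P >-> R}) : Prop :=
  forall (J : {fset nat}) (A : nat -> set R),
    (forall j, measurable (A j)) ->
    P (\bigcap_(j in [set` J]) (Y j @^-1` A j)) =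
    (\prod_(j <- J) P (Y j @^-1` A j))%E.

(* The last two clauses determine the law of each Y n, so the sequence is
   identically distributed. *)
Definition iid_rademacher (Y : nat -> {RV P >-> R}) : Prop :=
  [/\ mutually_independent Y,
      forall n w, Y n w = -1 \/ Y n w = 1 &
      forall n, P [set w | Y n w = 1] = (2^-1)%:E].

Definition Z_sum (H : R) (Y : nat -> {RV P >-> R}) (w : T) : R :=
  limn (series (fun m => 2 `^ (m%:R * (H - 1)) * Y m w)).

End Rademacher.

(* Main.v *)
(* Put [h = 2^H], [r = h / 2] and rescale the increments to
   [D n j = h^n (x ((j+1)/2^n) - x (j/2^n))]. Passing from level [n] to level
   [n+1] replaces [D n j] by the two values [r (D n j + 1)] and
   [r (D n j - 1)]; the coefficient theta only decides which of the two comes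
   first. Hence the sum of [f (D (n+k) j)] over the [2^k] descendants of [i] is
   [2^k] times the average of [f (r^k D n i + sum_(i<k) +-r^(i+1))] over all
   signs, which is an expectation of Rademacher variables and converges to
   [E (f (r Z_H))] by dominated convergence when [f = |.|^p]. Since
   [h^(1/H) = 2], the weight [h^(-np)] balances the number [2^n] of intervals
   exactly when [p = 1/H]; for other [p] it suffices that these averages are
   bounded, and bounded away from 0. *)

Require Import Defs.
From mathcomp Require Import all_boot all_order all_algebra.
From mathcomp Require Import all_classical all_reals all_analysis.
From mathcomp Require Import measurable_realfun finmap ring lra.

Import Order.TTheory GRing.Theory Num.Theory.
Import numFieldNormedType.Exports.
Local Open Scope classical_set_scope.
Local Open Scope ring_scope.

(** * The tent function on dyadic grids *)

Section Tent.
Context {R : realType}.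
Implicit Types u v : R.

Lemma e00_le0 u : u <= 0 -> e00 u = 0.
Proof.
move=> u0; rewrite /e00 min_l; last by lra.
by rewrite max_r.
Qed.

Lemma e00_ge1 u : 1 <= u -> e00 u = 0.
Proof.
move=> u1; rewrite /e00 min_r; last by lra.
by rewrite max_r//; lra.
Qed.

Lemma e00_rising u : 0 <= u <= 2^-1 -> e00 u = u.
Proof. by move=> ?; rewrite /e00 min_l ?max_l; lra. Qed.

Lemma e00_falling u : 2^-1 <= u <= 1 -> e00 u = 1 - u.
Proof. by move=> ?; rewrite /e00 min_r ?max_l; lra. Qed.

Lemma e00_int (z : int) : e00 (z%:~R : R) = 0.
Proof.
have [z0|z0] := leP z 0; first by rewrite e00_le0// -[0]/(0%:~R) ler_int.
by rewrite e00_ge1// -[1]/(1%:~R) ler_int.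
Qed.

(** The kinks 0, 1/2 and 1 of the tent are all multiples of [1 / (2 * D)], so the tent is affine
    between consecutive multiples. The case split on [a] runs through the four affine pieces. *)
Lemma e00_midpoint (D : nat) (a : int) : (0 < D)%N ->
  e00 ((2 * a + 1)%:~R / (4 * D%:R)) =
  (e00 (a%:~R / (2 * D%:R)) + e00 ((a + 1)%:~R / (2 * D%:R))) / 2 :> R.
Proof.
move=> D0; have D0' : 0 < D%:R :> R by rewrite ltr0n.
set u := a%:~R / _; set v := (a + 1)%:~R / _.
have -> : (2 * a + 1)%:~R / (4 * D%:R) = (u + v) / 2 :> R.
  by rewrite /u /v !rmorphD rmorphM/=; field; rewrite lt0r_neq0.
have uv : u <= v by rewrite ler_pM2r ?invr_gt0 ?mulr_gt0// ler_int lerDl.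
have [a1|a1] := ltP a 0.
  have v0 : v <= 0 by rewrite pmulr_lle0 ?invr_gt0 ?mulr_gt0// lerz0 lezD1.
  by rewrite !e00_le0//; lra.
have u0 : 0 <= u by rewrite divr_ge0 ?ler0z// mulr_ge0.
have [a2|a2] := ltP a D.
  have v1 : v <= 2^-1.
    rewrite ler_pdivrMr ?mulr_gt0// mulKf//.
    by rewrite -[D%:R]/(D%:Z%:~R) ler_int lezD1.
  by rewrite !e00_rising//; lra.
have u1 : 2^-1 <= u.
  by rewrite ler_pdivlMr ?mulr_gt0// mulKf// -[D%:R]/(D%:Z%:~R) ler_int.
have [a3|a3] := ltP a (2 * D)%N.
  have v1 : v <= 1.
    rewrite ler_pdivrMr ?mulr_gt0// mul1r -natrM.
    by rewrite -[_%:R]/((2 * D)%N%:Z%:~R) ler_int lezD1.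
  by rewrite !e00_falling//; lra.
have u2 : 1 <= u.
  rewrite ler_pdivlMr ?mulr_gt0// mul1r -natrM.
  by rewrite -[_%:R]/((2 * D)%N%:Z%:~R) ler_int.
by rewrite !e00_ge1//; lra.
Qed.

End Tent.

(** * Values of Faber-Schauder functions and of their signed sums at dyadic points *)

Section SchauderExpansion.
Context {R : realType}.
Implicit Types (H : R) (x : R -> R) (theta : nat -> nat -> R) (n m j k : nat).

(** For [n <= m] the argument of the tent is an integer. *)
Lemma faber_schauder_dyadic m (k : int) n j : (n <= m)%N ->
  faber_schauder m k (j%:R * 2 ^- n) = 0 :> R.
Proof.
move=> nm; rewrite /faber_schauder.
have -> : 2 ^+ m * (j%:R * 2 ^- n) - k%:~R = ((2 ^ (m - n) * j)%N%:Z - k)%:~R :> R.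
  rewrite rmorphB/= -!pmulrn natrM natrX -[in LHS](subnK nm) exprD.
  by field; rewrite expf_neq0.
by rewrite e00_int mulr0.
Qed.

(** A function of level [m] has its kinks on the grid of level [m.+1], hence is affine on every
    dyadic interval of a level [n > m]. *)
Lemma faber_schauder_midpoint_lt m (k : int) n j : (m < n)%N ->
  faber_schauder m k (j.*2.+1%:R * 2 ^- n.+1) =
  (faber_schauder m k (j%:R * 2 ^- n) +
   faber_schauder m k (j.+1%:R * 2 ^- n)) / 2 :> R.
Proof.
move=> mn; rewrite /faber_schauder -mulrDr -mulrA; congr (_ * _).
have D0 : (0 < 2 ^ (n - m.+1))%N by rewrite expn_gt0.
have nE : 2 ^+ n = 2 ^+ m * (2 * (2 ^ (n - m.+1))%:R) :> R.
  by rewrite natrX -exprS -exprD -subSn// subSS subnKC// ltnW.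
set D := (2 ^ (n - m.+1))%N in D0 nE.
have D0' : D%:R != 0 :> R by rewrite pnatr_eq0 -lt0n.
have m0 : 2 ^+ m != 0 :> R by rewrite expf_neq0.
have jE : j.*2.+1%:R = 2 * j%:R + 1 :> R by rewrite -natr1 -muln2 natrM mulrC.
(* Since [2 ^+ n] is [2 ^+ m * (2 * D)], the map [t |-> 2 ^+ m * t - k] sends the two endpoints to
   [a / (2 * D)] and [(a + 1) / (2 * D)]. *)
pose a : int := j%:Z - 2 * D%:Z * k.
have aE : a%:~R = j%:R - 2 * D%:R * k%:~R :> R.
  by rewrite rmorphB !rmorphM/= -!pmulrn.
have -> : 2 ^+ m * (j.*2.+1%:R * 2 ^- n.+1) - k%:~R =
    (2 * a + 1)%:~R / (4 * D%:R) :> R.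
  by rewrite rmorphD rmorphM/= aE exprS nE jE; field; rewrite D0' m0.
have -> : 2 ^+ m * (j%:R * 2 ^- n) - k%:~R = a%:~R / (2 * D%:R) :> R.
  by rewrite aE nE; field; rewrite D0' m0.
have -> : 2 ^+ m * (j.+1%:R * 2 ^- n) - k%:~R = (a + 1)%:~R / (2 * D%:R) :> R.
  by rewrite rmorphD/= aE nE -natr1; field; rewrite D0' m0.
exact: e00_midpoint.
Qed.

(** The midpoint of the interval [j] is the peak of the function with [k = j] and lies outside the
    open support of the others. *)
Lemma faber_schauder_midpoint_eq n k j :
  faber_schauder n k (j.*2.+1%:R * 2 ^- n.+1) =
  2 `^ (- (n%:R / 2)) * ((k == j)%:R / 2) :> R.
Proof.
rewrite /faber_schauder; congr (_ * _).
have -> : 2 ^+ n * (j.*2.+1%:R * 2 ^- n.+1) - k%:~R = j%:R - k%:R + 2^-1 :> R.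
  have -> : j.*2.+1%:R = 2 * j%:R + 1 :> R by rewrite -natr1 -muln2 natrM mulrC.
  by rewrite exprS -pmulrn; field; rewrite expf_neq0.
have [kj|kj|->] := ltngtP k j.
- by rewrite mul0r e00_ge1//; move: kj; rewrite -(ler_nat R) -natr1; lra.
- by rewrite mul0r e00_le0//; move: kj; rewrite -(ler_nat R) -natr1; lra.
- by rewrite subrr add0r mul1r e00_rising; lra.
Qed.

Lemma signed_takagi_partial_dyadic H theta n N j : (n <= N)%N ->
  signed_takagi_partial H theta N (j%:R * 2 ^- n) =
  signed_takagi_partial H theta n (j%:R * 2 ^- n).
Proof.
move=> nN; rewrite /signed_takagi_partial (big_cat_nat (n := n))//=.
rewrite -[RHS]addr0; congr (_ + _); rewrite big_nat big1// => m /andP[nm _].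
by rewrite big1 ?mulr0// => k _; rewrite faber_schauder_dyadic ?mulr0.
Qed.

Lemma signed_takagi_partial_midpoint H theta n j : (j < 2 ^ n)%N ->
  signed_takagi_partial H theta n.+1 (j.*2.+1%:R * 2 ^- n.+1) =
  (signed_takagi_partial H theta n (j%:R * 2 ^- n) +
   signed_takagi_partial H theta n (j.+1%:R * 2 ^- n)) / 2 +
  (2 `^ H) ^- n * theta n j / 2.
Proof.
move=> jn; rewrite /signed_takagi_partial big_nat_recr//=; congr (_ + _).
  rewrite -big_split/= mulr_suml !big_nat; apply: eq_bigr => m /andP[_ mn].
  rewrite -mulrDr -big_split/=. rewrite -[RHS]mulrA mulr_suml; congr (_ * _).
  by apply: eq_bigr => k _; rewrite faber_schauder_midpoint_lt//; ring.
rewrite (bigD1_seq j)/= ?iota_uniq ?mem_index_iota//= big1 ?addr0; last first.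
  by move=> k /negPf kj; rewrite faber_schauder_midpoint_eq kj mul0r !mulr0.
(* The weight of the series and the normalisation of the Schauder function combine to
   [2 ^ (- n H)]. *)
have -> : (2 `^ H) ^- n = 2 `^ (n%:R * (2^-1 - H)) * 2 `^ (- (n%:R / 2)) :> R.
  rewrite -powR_mulrn ?powR_ge0// -powRrM -powRN -powRD; last first.
    by rewrite pnatr_eq0 implybT.
  by congr (_ `^ _); field.
by rewrite faber_schauder_midpoint_eq eqxx mul1r; ring.
Qed.

(** At a dyadic point of level [n] the partial sums are constant from index [n] on, so their limit
    is a finite sum. *)
Lemma signed_takagi_landsberg_dyadic H x : signed_takagi_landsberg H x ->
  exists2 theta : nat -> nat -> R,
    (forall m k, (k < 2 ^ m)%N -> theta m k = -1 \/ theta m k = 1) &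
    (forall n j, (j <= 2 ^ n)%N ->
       x (j%:R * 2 ^- n) = signed_takagi_partial H theta n (j%:R * 2 ^- n)).
Proof.
move=> [_ [theta [theta1 cvg_x]]]; exists theta => // n j jn.
set t := j%:R * 2 ^- n.
have t01 : [set t] `<=` `[0 : R, 1].
  move=> _ ->; rewrite /= in_itv/= /t mulr_ge0//=.
  by rewrite ler_pdivrMr ?exprn_gt0// mul1r -natrX ler_nat.
have cvg_xt : signed_takagi_partial H theta N t @[N --> \oo] --> x t.
  by have := uniform_subset_cvg _ t01 cvg_x; rewrite uniform_set1; exact.
rewrite -(cvg_lim (@Rhausdorff R) cvg_xt); apply: lim_near_cst => //.
near=> N; apply: signed_takagi_partial_dyadic.
by near: N; exact: nbhs_infty_ge.
Unshelve. all: by end_near. Qed.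

End SchauderExpansion.

(** * Binary trees of rescaled increments and averages over signs *)

Section SignTree.
Context {R : realType}.
Implicit Types (r u : R) (D : nat -> nat -> R) (f : R -> R) (n m k i j : nat).

(** The children of node [j] are [2j] and [2j+1]. The sign [e] is existential because sums over all
    descendants do not depend on the order of the two children. *)
Definition sign_tree r D := D 0 0 = 0 /\
  forall n j, (j < 2 ^ n)%N -> exists2 e : R, e = -1 \/ e = 1 &
    D n.+1 j.*2 = r * (D n j + e) /\ D n.+1 j.*2.+1 = r * (D n j - e).

(* The average of [f (u + e_1 r + ... + e_k r^k)] over all signs [e_i]. *)
Fixpoint sign_avg r f k u : R :=
  if k is k'.+1 then
    (sign_avg r f k' (u + r ^+ k) + sign_avg r f k' (u - r ^+ k)) / 2
  else f u.

(** One step down the tree from the root peels off the sign with the highest power of [r], which is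
    the outermost one in [sign_avg]. *)
Lemma sign_avg_step r f k u :
  sign_avg r f k.+1 (r ^+ k.+1 * u) =
  (sign_avg r f k (r ^+ k * (r * (u + 1))) +
   sign_avg r f k (r ^+ k * (r * (u - 1)))) / 2.
Proof. by congr ((sign_avg _ _ _ _ + sign_avg _ _ _ _) / 2); rewrite exprS; ring. Qed.

(** Induction on [k] from the top: the descendants of [i] are those of its two children, and the
    average is symmetric in the sign [e]. *)
Lemma sum_sign_tree r D f n i k : sign_tree r D -> (i < 2 ^ n)%N ->
  \sum_(i * 2 ^ k <= j < i.+1 * 2 ^ k) f (D (k + n)%N j) =
  2 ^+ k * sign_avg r f k (r ^+ k * D n i).
Proof.
move=> [_ Dstep]; elim: k n i => [|k IHk] n i ilt.
  by rewrite !muln1 big_nat1 /= !mul1r.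
rewrite sign_avg_step.
have -> : (i * 2 ^ k.+1 = i.*2 * 2 ^ k)%N by rewrite expnS mulnA muln2.
have -> : (i.+1 * 2 ^ k.+1 = i.*2.+2 * 2 ^ k)%N by rewrite expnS mulnA muln2.
rewrite (big_cat_nat (n := (i.*2.+1 * 2 ^ k)%N))/=; last 2 first.
- by rewrite leq_mul2r leqnSn orbT.
- by rewrite leq_mul2r leqnSn orbT.
rewrite addSnnS !IHk; try by rewrite expnS mul2n ?ltn_double ?ltn_Sdouble.
rewrite exprS; have [e [] -> [-> ->]] := Dstep n i ilt; rewrite ?opprK; first by field.
by field.
Qed.

(** The bound is the fixed point of [b |-> r * (b + 1)], the worst growth in one step. *)
Lemma sign_tree_bound r D n j : 0 < r < 1 -> sign_tree r D -> (j < 2 ^ n)%N ->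
  `|D n j| <= r / (1 - r).
Proof.
move=> /andP[r0 r1] [D00 Dstep]; elim: n j => [|n IHn] j jlt.
  move: jlt; rewrite expn0 ltnS leqn0 => /eqP ->; rewrite D00 normr0.
  by rewrite divr_ge0 ?subr_ge0 ?ltW.
have step e : e = -1 \/ e = 1 -> forall i, (i < 2 ^ n)%N ->
    `|r * (D n i + e)| <= r / (1 - r).
  move=> e1 i ilt; rewrite normrM gtr0_norm//.
  have -> : r / (1 - r) = r * (r / (1 - r) + 1) by field; lra.
  rewrite ler_pM2l//; apply: (le_trans (ler_normD _ _)).
  by rewrite lerD ?IHn//; case: e1 => ->; rewrite ?normrN normr1.
have i2 : (j./2 < 2 ^ n)%N by rewrite ltn_half_double -mul2n -expnS.
have [e e1 [De Do]] := Dstep _ _ i2.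
rewrite -(odd_double_half j); case: (odd j); rewrite /= ?add1n ?add0n ?De ?Do.
  by apply: step => //; case: e1 => ->; rewrite ?opprK; [right|left].
exact: step.
Qed.

End SignTree.

(** * Dyadic increments of a signed Takagi-Landsberg function *)

Section DyadicIncrements.
Context {R : realType}.
Implicit Types (H p t : R) (x : R -> R) (n j : nat).

Definition dyadic_increment x n j : R := x (j.+1%:R * 2 ^- n) - x (j%:R * 2 ^- n).

Lemma dyadic_succE n j : (j < 2 ^ n)%N ->
  dyadic_succ n (j%:R * 2 ^- n) = j.+1%:R * 2 ^- n :> R.
Proof.
move=> jn; have n0 : 0 < 2 ^- n :> R by rewrite invr_gt0 exprn_gt0.
have lt_dyadic (i k : nat) : (i%:R * 2 ^- n < k%:R * 2 ^- n :> R) = (i < k)%N.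
  by rewrite ltr_pM2r// ltr_nat.
rewrite /dyadic_succ /dyadic big_map.
have one_dyadic : 1 = (2 ^ n)%N%:R * 2 ^- n :> R by rewrite natrX divff// expf_neq0.
have -> : j%:R * 2 ^- n < 1 :> R by rewrite [ltRHS]one_dyadic lt_dyadic.
apply/le_anti; rewrite (@bigmin_inf_seq _ _ _ _ _ j.+1)//=; last 2 first.
- by rewrite in_cons mem_iota.
- by rewrite lt_dyadic.
apply: le_bigmin; first by rewrite [leRHS]one_dyadic ler_pM2r// ler_nat.
by move=> k; rewrite lt_dyadic ler_pM2r// ler_nat.
Qed.

Lemma dyadic_pvarE x p t n : 0 < p ->
  dyadic_pvar x p t n =
  \sum_(0 <= j < 2 ^ n | j%:R * 2 ^- n <= t) `|dyadic_increment x n j| `^ p.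
Proof.
move=> p0; rewrite /dyadic_pvar /dyadic big_map -[iota _ _]/(index_iota 0 (2 ^ n).+1).
(* The last point [s = 1] is its own successor; its term is 0 to the power [p], which vanishes as
   [p > 0]. *)
rewrite big_mkcond big_nat_recr//= -big_mkcond/=.
rewrite natrX divff ?expf_neq0// /dyadic_succ ltxx subrr normr0 powR0 ?gt_eqF//.
rewrite if_same addr0 big_nat_cond [RHS]big_nat_cond; apply: eq_bigr => j.
by move=> /andP[/andP[_ jn] _]; rewrite -/(dyadic_succ _ _) dyadic_succE.
Qed.

(** The midpoint formula halves an increment and adds or subtracts [h ^- n * theta n j / 2] with
    [h = 2 ^ H]; multiplication by [h ^+ n.+1] turns this into [r * (D n j +- theta n j)]. *)
Lemma sign_tree_takagi H x : signed_takagi_landsberg H x ->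
  sign_tree (2 `^ H / 2) (fun n j => (2 `^ H) ^+ n * dyadic_increment x n j).
Proof.
move=> /signed_takagi_landsberg_dyadic[theta theta1 xE].
have h0 : 2 `^ H != 0 :> R by rewrite gt_eqF// powR_gt0.
split.
  rewrite /dyadic_increment !xE// /signed_takagi_partial !big_geq//.
  by rewrite subrr mulr0.
move=> n j jn; exists (theta n j); first exact: theta1.
have lo : j.*2%:R * 2 ^- n.+1 = j%:R * 2 ^- n :> R.
  by rewrite -muln2 natrM exprS; field; rewrite expf_neq0.
have hi : j.*2.+2%:R * 2 ^- n.+1 = j.+1%:R * 2 ^- n :> R.
  by rewrite -doubleS -muln2 natrM exprS; field; rewrite expf_neq0.
have mid : x (j.*2.+1%:R * 2 ^- n.+1) =
    (x (j%:R * 2 ^- n) + x (j.+1%:R * 2 ^- n)) / 2 + (2 `^ H) ^- n * theta n j / 2.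
  rewrite xE; last by rewrite expnS mul2n ltn_double.
  by rewrite signed_takagi_partial_midpoint// -!xE// ltnW.
rewrite /dyadic_increment lo hi mid exprS.
by split; field; rewrite ?expf_neq0.
Qed.

End DyadicIncrements.

(** * Limits and lower bounds for sums over a sign tree *)

Section SignTreeLimits.
Context {R : realType}.
Implicit Types (r u t L M p : R) (D : nat -> nat -> R) (f : R -> R) (n m k i j : nat).

(** Here [N] is the integer part of [t * 2 ^+ n]. The fine points up to [t] are the full blocks
    below [N] and some of the [2 ^ k] points of the block [N]. *)
Lemma sum_dyadic_prefix (F : nat -> R) M t n N k :
  (forall j, (j < 2 ^ (k + n))%N -> 0 <= F j <= M) ->
  0 <= M -> (N <= 2 ^ n)%N -> N%:R <= t * 2 ^+ n < N.+1%:R ->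
  \sum_(0 <= j < N * 2 ^ k) F j <=
    \sum_(0 <= j < 2 ^ (k + n) | j%:R * 2 ^- (k + n) <= t) F j <=
    \sum_(0 <= j < N * 2 ^ k) F j + 2 ^+ k * M.
Proof.
move=> F0M M0 Nn /andP[Nt tN].
have Nk : (N * 2 ^ k <= 2 ^ (k + n))%N by rewrite addnC expnD leq_mul2r Nn orbT.
have le_t j : (j%:R * 2 ^- (k + n) <= t) = (j%:R <= t * 2 ^+ n * 2 ^+ k).
  by rewrite ler_pdivrMr ?exprn_gt0// addnC exprD mulrA.
rewrite [X in _ <= X <= _](big_cat_nat (n := (N * 2 ^ k)%N))//=.
have -> : \sum_(0 <= j < N * 2 ^ k | j%:R * 2 ^- (k + n) <= t) F j =
          \sum_(0 <= j < N * 2 ^ k) F j.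
  rewrite big_mkcond; apply: eq_big_nat => j /andP[_ jN]; rewrite le_t.
  rewrite (le_trans _ (_ : N%:R * 2 ^+ k <= _)) ?ler_pM2r ?exprn_gt0//.
  by rewrite -natrX -natrM ler_nat ltnW.
rewrite lerDl lerD2l; apply/andP; split.
  rewrite big_nat_cond sumr_ge0// => j /andP[/andP[_ jn] _].
  by have /andP[] := F0M j jn.
apply: (@le_trans _ _ (\sum_(N * 2 ^ k <= j < 2 ^ (k + n) | (j < N.+1 * 2 ^ k)%N) M)).
  rewrite big_mkcond [leRHS]big_mkcond/= big_nat_cond [leRHS]big_nat_cond.
  rewrite ler_sum// => j /andP[/andP[_ jn] _].
  rewrite le_t; case: (lerP j%:R (t * 2 ^+ n * 2 ^+ k)) => [jt|_]; last by case: ifP.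
  have -> : (j < N.+1 * 2 ^ k)%N.
    rewrite -(ltr_nat R) natrM natrX; apply: le_lt_trans jt _.
    by rewrite ltr_pM2r ?exprn_gt0.
  by have /andP[] := F0M j jn.
have -> : 2 ^+ k * M = \sum_(N * 2 ^ k <= j < N.+1 * 2 ^ k) M.
  by rewrite sumr_const_nat mulSn addnK -[M *+ _]mulr_natl natrX.
(* The block [N] lies past the last index when [N = 2 ^ n], as happens for [t = 1]. *)
have [le_n|/ltnW le_n] := leqP (N.+1 * 2 ^ k) (2 ^ (k + n)).
  by rewrite (big_nat_widen _ _ _ _ _ le_n).
rewrite [leRHS](big_cat_nat (n := (2 ^ (k + n))%N))//= -[leLHS]addr0 lerD//.
  by rewrite big_mkcond/= ler_sum// => j _; case: ifP.
exact: sumr_ge0.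
Qed.

(** Two scales: a coarse level [n] is fixed first, then [k] tends to infinity. Only finitely many
    nodes of level [n] occur, so the convergence of the averages need not be uniform in the node. *)
Lemma sign_tree_cvg r D f M L t : sign_tree r D ->
  (forall n j, (j < 2 ^ n)%N -> 0 <= f (D n j) <= M) ->
  (forall n i, (i < 2 ^ n)%N -> sign_avg r f k (r ^+ k * D n i) @[k --> \oo] --> L) ->
  0 <= t <= 1 ->
  2 ^- n * \sum_(0 <= j < 2 ^ n | j%:R * 2 ^- n <= t) f (D n j) @[n --> \oo] --> t * L.
Proof.
move=> treeD f0M cvg_avg /andP[t0 t1].
have M0 : 0 <= M by have /andP[] := f0M 0%N 0%N erefl; exact: le_trans.
apply/cvgrPdist_le => e e0.
(* [M] pays for the incomplete block containing [t], and [L] for replacing [t * 2 ^+ n] by its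
   integer part; the other half of [e] is left for the averages. *)
have [n small_n] : exists n, 2 ^- n * (M + `|L|) <= e / 2.
  have : 2 ^- n * (M + `|L|) @[n --> \oo] --> 0 * (M + `|L|).
    apply: cvgMl; rewrite (_ : (fun n => _) = (fun n => 2^-1 ^+ n)).
      by apply: cvg_expr; rewrite gtr0_norm//; lra.
    by apply/funext => n; rewrite exprVn.
  rewrite mul0r => /cvgrPdist_le /(_ (e / 2)); rewrite divr_gt0// => /(_ isT)[n _ /(_ n)].
  rewrite /= leqnn => /(_ isT); rewrite sub0r normrN => en; exists n.
  exact: le_trans (ler_norm _) en.
pose N := Num.truncn (t * 2 ^+ n).
have tn0 : 0 <= t * 2 ^+ n by rewrite mulr_ge0// exprn_ge0.
have Nt : N%:R <= t * 2 ^+ n < N.+1%:R by exact: truncn_itv.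
have Nn : (N <= 2 ^ n)%N.
  rewrite -(ler_nat R) natrX; case/andP: Nt => [Nt _]; apply: le_trans Nt _.
  by rewrite ler_piMl// exprn_ge0.
have : \sum_(0 <= i < N) sign_avg r f k (r ^+ k * D n i) @[k --> \oo] --> \sum_(0 <= i < N) L.
  elim: (N) Nn => [_|N' IHN N'n].
    by rewrite big_geq//; under eq_cvg do rewrite big_geq//; exact: cvg_cst.
  rewrite big_nat_recr//=; under eq_cvg do rewrite big_nat_recr//=.
  by apply: cvgD; [exact: IHN (ltnW N'n)|exact: cvg_avg].
rewrite sumr_const_nat subn0 => /cvgrPdist_le/(_ (e / 2)).
rewrite divr_gt0// => /(_ isT)[K _ avg_near].
exists (K + n)%N => // m /= Km; have nm : (n <= m)%N := leq_trans (leq_addl _ _) Km.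
rewrite -(subnK nm); set k := (m - n)%N.
have /avg_near : (K <= k)%N by rewrite leq_subRL// addnC.
have := @sum_dyadic_prefix (fun j => f (D (k + n)%N j)) M t n N k (f0M _) M0 Nn Nt.
rewrite big_nat_mul; set S := \sum_(0 <= j < 2 ^ (k + n) | _) _.
have -> : \sum_(0 <= i < N) \sum_(i * 2 ^ k <= j < i.+1 * 2 ^ k) f (D (k + n)%N j) =
    2 ^+ k * \sum_(0 <= i < N) sign_avg r f k (r ^+ k * D n i).
  rewrite mulr_sumr; apply: eq_big_nat => i /andP[_ iN].
  by rewrite (@sum_sign_tree _ r D f)//; exact: leq_trans Nn.
set B := \sum_(0 <= i < N) _ => SB BL.
have n2 : 0 < 2 ^- n :> R by rewrite invr_gt0 exprn_gt0.
have k2 : 0 < 2 ^- k :> R by rewrite invr_gt0 exprn_gt0.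
have SB' : 2 ^- n * B <= 2 ^- (k + n) * S <= 2 ^- n * B + 2 ^- n * M.
  have -> : 2 ^- n * B = 2 ^- (k + n) * (2 ^+ k * B).
    by rewrite exprD; field; rewrite !expf_neq0.
  have -> : 2 ^- n * M = 2 ^- (k + n) * (2 ^+ k * M).
    by rewrite exprD; field; rewrite !expf_neq0.
  by rewrite -mulrDr !ler_pM2l// invr_gt0 exprn_gt0.
have BL' : `|2 ^- n * (L *+ N) - 2 ^- n * B| <= e / 2.
  rewrite -mulrBr normrM gtr0_norm// (le_trans _ BL)// ler_piMl//.
  by rewrite invf_le1 ?exprn_gt0// exprn_ege1// ler1n.
have NL : `|t * L - 2 ^- n * (L *+ N)| <= 2 ^- n * `|L|.
  have -> : t * L - 2 ^- n * (L *+ N) = 2 ^- n * ((t * 2 ^+ n - N%:R) * L).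
    by rewrite -mulr_natr; field; rewrite expf_neq0.
  rewrite !normrM gtr0_norm// ler_pM2l// ler_piMl//.
  by case/andP: Nt => N1 N2; rewrite ger0_norm ?subr_ge0// lerBlDl natr1 ltW.
move: NL BL' small_n; rewrite !ler_norml mulrDr => /andP[N1 N2] /andP[B1 B2] small_n.
case/andP: SB' => S1 S2; apply/andP; split; last first.
  lra.
lra.
Qed.

(** In the last generation one child of each pair has absolute value at least [r]; averaging over
    the earlier signs keeps the bound. *)
Lemma sign_avg_powR_ge r p k u : 0 < r -> 0 <= p ->
  r `^ p / 2 <= sign_avg r (fun v => `|v| `^ p) k.+1 (r ^+ k.+1 * u).
Proof.
move=> r0 p0; elim: k u => [|k IHk] u.
  rewrite sign_avg_step /= !mul1r ler_pM2r ?invr_gt0//.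
  have pow_ge v : 1 <= `|v| -> r `^ p <= `|r * v| `^ p.
    move=> v1; apply: ge0_ler_powR; rewrite ?nnegrE ?normr_ge0 ?(ltW r0)//.
    by rewrite normrM gtr0_norm// ler_peMr// ltW.
  (* One of [u + 1] and [u - 1] has absolute value at least 1. *)
  have [u0|u0] := leP 0 u.
    by rewrite -[leLHS]addr0 lerD ?powR_ge0 ?pow_ge// ger0_norm; lra.
  by rewrite -[leLHS]add0r lerD ?powR_ge0 ?pow_ge// ltr0_norm; lra.
rewrite sign_avg_step ler_pdivlMr//.
have -> : r `^ p / 2 * 2 = r `^ p / 2 + r `^ p / 2 by field.
by rewrite lerD ?IHk.
Qed.

End SignTreeLimits.

(** * Sign averages as expectations of Rademacher walks *)

Section Rademacher.
Context {R : realType} {d : measure_display} {T : measurableType d}.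
Context {P : probability T R} {Y : nat -> {RV P >-> R}}.
Hypothesis iidY : iid_rademacher Y.
Implicit Types (r u : R) (s : nat -> R) (f : R -> R) (n k : nat).

Let Y_pm1 n w : Y n w = -1 \/ Y n w = 1.
Proof. by case: iidY. Qed.

Let PY n (e : R) : e = -1 \/ e = 1 -> P (Y n @^-1` [set e]) = (2^-1)%:E.
Proof.
case: iidY => _ _ PY1.
have mY1 : measurable (Y n @^-1` [set 1]).
  by rewrite -[X in measurable X]setTI; exact: measurable_funP.
case=> ->; last exact: PY1.
have -> : Y n @^-1` [set -1] = ~` (Y n @^-1` [set 1]).
  apply/seteqP; split=> w /= Yw; last by case: (Y_pm1 n w).
  by rewrite Yw => /eqP; lra.
by rewrite probability_setC// [P _](PY1 n) -EFinB; congr EFin; field.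
Qed.

Let cylinder k n s : set T := \bigcap_(i in [set i | (k <= i < n)%N]) Y i @^-1` [set s i].

Let measurable_cylinder k n s : measurable (cylinder k n s).
Proof.
apply: bigcap_measurableType => i _.
by rewrite -[X in measurable X]setTI; exact: measurable_funP.
Qed.

Let P_cylinder n s : (forall i, s i = -1 \/ s i = 1) ->
  P (cylinder 0 n s) = (2 ^- n)%:E.
Proof.
move=> s1; case: iidY => indepY _ _.
have := indepY [fset i in iota 0 n]%fset (fun i => [set s i]) (fun i => measurable_set1 _).
have -> : [set` [fset i in iota 0 n]%fset] = [set i | (0 <= i < n)%N].
  by apply/seteqP; split => i /=; rewrite inE/= mem_iota.
rewrite -/(cylinder 0 n s) => ->.
rewrite (eq_bigr (fun=> (2^-1)%:E)); last by move=> i _; exact: PY.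
rewrite big_seq_fsetE/= prodEFin; congr EFin.
rewrite prodr_const -exprVn; congr (_ ^+ _).
by rewrite -cardfE card_fseq undup_id ?iota_uniq// size_iota.
Qed.

Let measurable_walk r f u k : measurable_fun setT f ->
  measurable_fun setT (fun w : T => f (u + \sum_(0 <= i < k) r ^+ i.+1 * Y i w)).
Proof.
move=> mf; apply: measurableT_comp => //.
apply: measurable_funD => //; apply: measurable_sum => i.
by apply: measurable_funM => //.
Qed.

(* Fixing the signs of index at least [k] makes an induction on [k] possible:
   the cylinder of level [k+1] splits according to the sign of [Y k]. *)
Let integral_cylinder r f u k n s : (forall i, s i = -1 \/ s i = 1) ->
  measurable_fun setT f -> (forall v, 0 <= f v) -> (k <= n)%N ->
  (\int[P]_(w in cylinder k n s) (f (u + \sum_(0 <= i < k) r ^+ i.+1 * Y i w))%:E =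
   (2 ^- (n - k) * sign_avg r f k u)%:E)%E.
Proof.
move=> + mf f0; elim: k u s => [|k IHk] u s s1 kn.
  under eq_integral do rewrite big_geq// addr0.
  by rewrite integral_cst//= [X in (_ * X)%E](P_cylinder _ _)//= -EFinM mulrC subn0.
pose flip e i : R := if i == k then e else s i.
have flip1 e : e = -1 \/ e = 1 -> forall i, flip e i = -1 \/ flip e i = 1.
  by move=> e1 i; rewrite /flip; case: ifP.
have -> : cylinder k.+1 n s = cylinder k n (flip 1) `|` cylinder k n (flip (-1)).
  apply/seteqP; split=> [w Cw|w [] Cw i /= /andP[ki iN]].
  - have Cflip e : Y k w = e -> cylinder k n (flip e) w.
      move=> Ye i /= /andP[ki iN]; rewrite /flip.
      by have [->//|ik] := eqVneq i k; apply: Cw; rewrite /= ltn_neqAle eq_sym ik ki.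
    by case: (Y_pm1 k w) => /Cflip; [right|left].
  - by have /= := Cw i; rewrite /flip gtn_eqF// (ltnW ki) iN; exact.
  - by have /= := Cw i; rewrite /flip gtn_eqF// (ltnW ki) iN; exact.
have Yk e w : cylinder k n (flip e) w -> Y k w = e.
  by move=> /(_ k) /=; rewrite leqnn kn /flip eqxx; exact.
rewrite ge0_integral_setU//=; last 3 first.
- by apply/measurable_EFinP; apply: measurable_funTS; exact: measurable_walk.
- by move=> w _; rewrite lee_fin.
- apply/disj_setPS => w [/Yk Yk1 /Yk]; rewrite Yk1 => /eqP; lra.
have step e : e = -1 \/ e = 1 ->
    (\int[P]_(w in cylinder k n (flip e)) (f (u + \sum_(0 <= i < k.+1) r ^+ i.+1 * Y i w))%:E =
     (2 ^- (n - k) * sign_avg r f k (u + r ^+ k.+1 * e))%:E)%E.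
  move=> e1; rewrite -(IHk _ (flip e)) ?(ltnW kn)//; last exact: flip1.
  (* On this cylinder [Y k] is the constant [e], so the last summand moves into the starting
     point. *)
  apply: eq_integral => w /set_mem/Yk Yw.
  by rewrite big_nat_recr//= Yw -addrA [_ + r ^+ _ * _]addrC.
rewrite !step; [|by left|by right].
rewrite -EFinD mulr1 mulrN1 -mulrDr subnS.
have -> : (n - k = (n - k).-1.+1)%N by rewrite prednK// subn_gt0.
by congr EFin; rewrite /= exprS; field; rewrite expf_neq0.
Qed.

(** This is the cylinder formula with [n = k]: no sign is prescribed, so the cylinder is the whole
    space. *)
Lemma expectation_rademacher_walk r f u k :
  measurable_fun setT f -> (forall v, 0 <= f v) ->
  ('E_P[fun w => f (u + \sum_(0 <= i < k) r ^+ i.+1 * Y i w)%R] = (sign_avg r f k u)%:E)%E.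
Proof.
move=> mf f0.
have := @integral_cylinder r f u k k (fun=> 1) (fun=> or_intror erefl) mf f0 (leqnn k).
rewrite subnn expr0 invr1 mul1r expectation.unlock => <-.
suff -> : cylinder k k (fun=> 1) = setT by [].
by apply/seteqP; split => // w _ i /= /andP[ki ik]; move: (leq_ltn_trans ki ik); rewrite ltnn.
Qed.

End Rademacher.

(** * Convergence of the walks to the Rademacher series and of their moments *)

Section RademacherSeries.
Context {R : realType}.

(** Away from 0 the power is differentiable; at 0 the radius [e ^ (1/p)] works directly. *)
Lemma continuous_norm_powR (p : R) : 0 < p -> continuous (fun u : R => `|u| `^ p).
Proof.
move=> p0 u; have [->|u0] := eqVneq u 0; last first.
  have cont_pow : {for `|u|, continuous (fun v : R => v `^ p)}.
    apply: differentiable_continuous; apply/derivable1_diffP.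
    by apply: derivable_powR; rewrite in_itv/= andbT normr_gt0.
  by apply: (continuous_comp _ cont_pow); exact: norm_continuous.
apply/cvgrPdist_le => e e0.
apply: filterS (@nbhs0_le R R^o _ (powR_gt0 p^-1 e0)) => v ve.
rewrite normr0 powR0 ?gt_eqF// sub0r normrN ger0_norm ?powR_ge0//.
rewrite -[leRHS]powRr1 ?(ltW e0)// -(mulVf (lt0r_neq0 p0)) powRrM.
by apply: ge0_ler_powR; rewrite ?nnegrE ?powR_ge0 ?(ltW p0).
Qed.

Lemma powR2_half_lt1 (H : R) : H < 1 -> 2 `^ H / 2 < 1 :> R.
Proof.
move=> H1; rewrite ltr_pdivrMr// mul1r -[ltRHS]powRr1// /powR gt_eqF// ltr_expR.
by rewrite ltr_pM2r// ln_gt0// ltr1n.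
Qed.

Lemma sum_expr_le (r : R) k : 0 <= r < 1 ->
  \sum_(0 <= i < k) r ^+ i.+1 <= r / (1 - r).
Proof.
move=> /andP[r0 r1]; have -> : \sum_(0 <= i < k) r ^+ i.+1 = r * (1 - r ^+ k) / (1 - r).
  elim: k => [|k IHk]; first by rewrite big_geq// expr0 subrr mulr0 mul0r.
  by rewrite big_nat_recr//= IHk exprS; field; lra.
rewrite ler_pM2r ?invr_gt0 ?subr_gt0// ler_piMr// gerBl.
exact: exprn_ge0.
Qed.

Context {d : measure_display} {T : measurableType d}.
Context {P : probability T R} {Y : nat -> {RV P >-> R}}.
Hypothesis iidY : iid_rademacher Y.

Let normY n w : `|Y n w| = 1.
Proof. by case: iidY => _ /(_ n w)[]-> _; rewrite ?normrN normr1. Qed.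

(** The weights of [Z_sum] are the powers of [r], so the series converges absolutely at every [w] by
    comparison with a geometric series. *)
Lemma rademacher_walk_cvg (H : R) w : H < 1 ->
  \sum_(0 <= i < k) (2 `^ H / 2) ^+ i.+1 * Y i w @[k --> \oo] --> 2 `^ H / 2 * Z_sum H Y w.
Proof.
move=> H1; set r := 2 `^ H / 2.
have r0 : 0 < r by rewrite divr_gt0// powR_gt0.
have r1 : r < 1 by exact: powR2_half_lt1.
have rE m : 2 `^ (m%:R * (H - 1)) = r ^+ m.
  rewrite mulrC powRrM powR_mulrn ?powR_ge0// powRB ?pnatr_eq0 ?implybT//.
  by rewrite powRr1.
have -> : Z_sum H Y w = limn (series (fun m => r ^+ m * Y m w)).
  by rewrite /Z_sum; congr (limn (series _)); apply/funext => m; rewrite rE.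
rewrite (_ : (fun k => _) = fun k => r * series (fun m => r ^+ m * Y m w) k); last first.
  apply/funext => k; rewrite /series/= mulr_sumr; apply: eq_bigr => i _.
  by rewrite exprS mulrA.
apply: cvgMr; apply: normed_cvg => /=.
apply: (@series_le_cvg _ _ (geometric 1 r)) => [n|n|n|].
- exact: normr_ge0.
- by rewrite /geometric/= mul1r exprn_ge0// ltW.
- by rewrite /geometric/= mul1r normrM normY mulr1 ger0_norm// exprn_ge0// ltW.
- by apply: is_cvg_geometric_series; rewrite gtr0_norm.
Qed.

(** The starting point [r ^+ k * u] tends to 0, so the limit does not depend on [u]; dominated
    convergence passes to expectations. *)
Lemma sign_avg_powR_cvg (H p : R) : H < 1 -> 0 < p ->
  exists2 c : R, ('E_P[fun w => (`|Z_sum H Y w| `^ p)%R] = c%:E)%E &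
  forall u, sign_avg (2 `^ H / 2) (fun v => `|v| `^ p) k ((2 `^ H / 2) ^+ k * u)
    @[k --> \oo] --> (2 `^ H / 2) `^ p * c.
Proof.
move=> H1 p0; set r := 2 `^ H / 2.
have r0 : 0 < r by rewrite divr_gt0// powR_gt0.
have r1 : r < 1 by exact: powR2_half_lt1.
pose f (v : R) := `|v| `^ p.
have mf : measurable_fun setT f by apply: continuous_measurable_fun; exact: continuous_norm_powR p0.
pose S u k w := r ^+ k * u + \sum_(0 <= i < k) r ^+ i.+1 * Y i w.
have S_cvg u w : S u k w @[k --> \oo] --> r * Z_sum H Y w.
  rewrite -[X in _ --> X]add0r; apply: cvgD; last exact: rademacher_walk_cvg.
  by rewrite -(mul0r u); apply: cvgMl; apply: cvg_expr; rewrite gtr0_norm.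
have mS u k : measurable_fun setT (S u k).
  apply: measurable_funD => //; apply: measurable_sum => i.
  by apply: measurable_funM.
have mfS u k : measurable_fun setT (fun w => (f (S u k w))%:E).
  by apply/measurable_EFinP; exact: measurableT_comp (mf) (mS u k).
have fS_cvg u w : (f (S u k w))%:E @[k --> \oo] --> (f (r * Z_sum H Y w))%:E.
  apply: cvg_EFin; first exact: nearW.
  have fc : {for (r * Z_sum H Y w), continuous f} by exact: continuous_norm_powR.
  have := cvg_comp _ _ (S_cvg u w) fc. exact.
have mfZ : measurable_fun setT (fun w => (f (r * Z_sum H Y w))%:E).
  exact: emeasurable_fun_cvg (mfS 0) (fun w _ => fS_cvg 0 w).
(* The start contributes at most the absolute value of [u], the walk at most the geometric sum
   [r / (1 - r)]. *)
pose C (u : R) := (`|u| + r / (1 - r)) `^ p.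
have f_bound u k w : (`|(f (S u k w))%:E| <= (C u)%:E)%E.
  rewrite lee_fin ger0_norm ?powR_ge0//; apply: ge0_ler_powR; rewrite ?nnegrE ?(ltW p0)//.
    by rewrite addr_ge0// divr_ge0 ?subr_ge0 ?ltW.
  apply: (le_trans (ler_normD _ _)); rewrite lerD//.
    by rewrite normrM normrX gtr0_norm// ler_piMl// exprn_ile1 ?ltW.
  apply: le_trans (@sum_expr_le r k _); last by rewrite ltW.
  apply: (le_trans (ler_norm_sum _ _ _)); apply: ler_sum => i _.
  by rewrite normrM normY mulr1 normrX gtr0_norm.
have iC u : P.-integrable setT (fun=> (C u)%:E) by exact: finite_measure_integrable_cst.
have DC u := dominated_convergence measurableT (mfS u) mfZ
  (aeW _ (fun w _ => fS_cvg u w)) (iC u) (aeW _ (fun w k _ => f_bound u k w)).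
have [iZ _ _] := DC 0.
set I := (\int[P]_w (f (r * Z_sum H Y w))%:E)%E.
have finI : I \is a fin_num by exact: integrable_fin_num.
have rp0 : 0 < r `^ p by exact: powR_gt0.
(* [I] is the moment of [r * Z_sum H Y]; the factor [r ^ p] comes out of it. *)
exists ((r `^ p)^-1 * fine I).
  rewrite expectation.unlock EFinM fineK// -integralZl//; apply: eq_integral => w _.
  by rewrite -EFinM /f normrM gtr0_norm// (powRM _ (ltW r0))// mulKf ?gt_eqF.
move=> u; rewrite mulVKf ?gt_eqF//; have [_ _] := DC u.
rewrite -/I -[I]fineK// => /fine_cvg; apply: cvg_trans; apply: near_eq_cvg; apply: nearW => k /=.
have := expectation_rademacher_walk iidY r f (r ^+ k * u) k mf (fun v => powR_ge0 _ _).
by rewrite expectation.unlock => ->.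
Qed.

End RademacherSeries.

(** * The three regimes of the exponent [p] *)

Section TakagiVariation.
Context {R : realType} {H : R} {x : R -> R}.
Hypotheses (H0 : 0 < H) (H1 : H < 1) (xH : signed_takagi_landsberg H x).
Implicit Types p t : R.

Let h : R := 2 `^ H.
Let r : R := h / 2.
Let D n j : R := h ^+ n * dyadic_increment x n j.
Let treeD : sign_tree r D. Proof. exact: sign_tree_takagi. Qed.

Let h0 : 0 < h. Proof. exact: powR_gt0. Qed.
Let r0 : 0 < r. Proof. by rewrite divr_gt0. Qed.
Let r1 : r < 1. Proof. exact: powR2_half_lt1. Qed.

Let hpE p : h `^ p = 2 `^ (H * p). Proof. by rewrite powRrM. Qed.

Let powR_D_bound p n j : 0 < p -> (j < 2 ^ n)%N ->
  0 <= `|D n j| `^ p <= (r / (1 - r)) `^ p.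
Proof.
move=> p0 jn; rewrite powR_ge0/=; apply: ge0_ler_powR; rewrite ?nnegrE ?(ltW p0)//.
  by rewrite divr_ge0 ?subr_ge0 ?ltW.
by apply: (sign_tree_bound r D) => //; rewrite r0 r1.
Qed.

Let pvarE p t n : 0 < p -> dyadic_pvar x p t n =
  (h `^ p) ^- n * \sum_(0 <= j < 2 ^ n | j%:R * 2 ^- n <= t) `|D n j| `^ p.
Proof.
move=> p0; rewrite dyadic_pvarE// mulr_sumr; apply: eq_bigr => j _.
have hn0 : 0 < h ^+ n by exact: exprn_gt0.
rewrite /D normrM gtr0_norm// powRM ?(ltW hn0)//.
rewrite -[h ^+ n]powR_mulrn ?(ltW h0)// powRAC powR_mulrn ?powR_ge0//.
by rewrite mulKf// expf_neq0// gt_eqF// powR_gt0.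
Qed.

(** At most [2 ^ n] terms occur, each at most a constant times [h ^ (- n p)], and [h ^ p > 2]. *)
Lemma dyadic_pvar_takagi_gt p t : H^-1 < p -> dyadic_pvar x p t n @[n --> \oo] --> 0.
Proof.
move=> Hp; have p0 : 0 < p by apply: lt_trans Hp; rewrite invr_gt0.
have hp2 : 2 < h `^ p.
  rewrite hpE -[ltLHS]powRr1// /powR gt_eqF// ltr_expR ltr_pM2r ?ln_gt0 ?ltr1n//.
  by rewrite mulrC -ltr_pdivrMr// div1r.
have hp0 : 0 < h `^ p by exact: powR_gt0.
pose C := (r / (1 - r)) `^ p.
apply: (@squeeze_cvgr _ _ _ _ (fun=> 0) (fun n => (2 / h `^ p) ^+ n * C)); last 2 first.
- exact: cvg_cst.
- rewrite -(mul0r C); apply: cvgMl; apply: cvg_expr.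
  by rewrite gtr0_norm ?divr_gt0// ltr_pdivrMr// mul1r.
apply: nearW => n; rewrite pvarE// mulr_ge0/=; last 2 first.
- by rewrite invr_ge0 exprn_ge0 ?powR_ge0.
- by rewrite sumr_ge0// => j _; exact: powR_ge0.
rewrite expr_div_n mulrAC [leRHS]mulrC ler_pM2l ?invr_gt0 ?exprn_gt0//.
apply: (@le_trans _ _ (\sum_(0 <= j < 2 ^ n) C)); last first.
  by rewrite sumr_const_nat subn0 -[C *+ _]mulr_natl natrX.
rewrite big_mkcond big_nat_cond [leRHS]big_nat_cond ler_sum// => j /andP[/andP[_ jn] _].
case: ifP => _; last exact: powR_ge0.
by have /andP[] := @powR_D_bound p n j p0 jn.
Qed.

(** Descendants of one interval [[0, 2 ^- m]] inside [[0, t]] suffice: their average is bounded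
    below, and [h ^ p < 2] makes the prefactor diverge. *)
Lemma dyadic_pvar_takagi_lt p t : 0 < p -> p < H^-1 -> 0 < t ->
  dyadic_pvar x p t n @[n --> \oo] --> +oo.
Proof.
move=> p0 pH t0.
have hp0 : 0 < h `^ p by exact: powR_gt0.
have hp2 : h `^ p < 2.
  rewrite hpE -[ltRHS]powRr1// /powR gt_eqF// ltr_expR ltr_pM2r ?ln_gt0 ?ltr1n//.
  by rewrite mulrC -ltr_pdivlMr// div1r.
have [m mt] : exists m, 2 ^- m <= t.
  have : (2^-1 : R) ^+ n @[n --> \oo] --> 0 by apply: cvg_expr; rewrite gtr0_norm; lra.
  move=> /cvgrPdist_le/(_ t t0)[m _ /(_ m (leqnn _))].
  by rewrite sub0r normrN exprVn ger0_norm ?invr_ge0 ?exprn_ge0//; exists m.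
have lower n : (m < n)%N ->
    (2 / h `^ p) ^+ n * (2 ^- m * (r `^ p / 2)) <= dyadic_pvar x p t n.
  move=> mn; rewrite pvarE// expr_div_n.
  rewrite [_ / _]mulrC -mulrA ler_pM2l ?invr_gt0 ?exprn_gt0// mulrA.
  have nE : ((n - m.+1).+1 + m = n)%N by rewrite addSnnS subnK.
  (* The depth below level [m] is written [k.+1], since the lower bound on the average needs at
     least one sign. *)
  set k := (n - m.+1)%N in nE.
  have := @sum_sign_tree R r D (fun v => `|v| `^ p) m 0 k.+1 treeD.
  rewrite expn_gt0 mul0n mul1n nE => /(_ isT) sumE.
  have -> : 2 ^+ n / 2 ^+ m = 2 ^+ k.+1 :> R by rewrite -nE exprD mulfK// expf_neq0.
  apply: (@le_trans _ _ (\sum_(0 <= j < 2 ^ k.+1) `|D n j| `^ p)).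
    by rewrite sumE ler_pM2l ?exprn_gt0// sign_avg_powR_ge// ltW.
  have kn : (2 ^ k.+1 <= 2 ^ n)%N by rewrite leq_exp2l// -nE leq_addr.
  rewrite (big_nat_widen _ _ _ _ _ kn) big_mkcond [leRHS]big_mkcond/= ler_sum// => j _.
  case: ifP => [jk|_]; last by case: ifP => // _; exact: powR_ge0.
  rewrite ifT// (le_trans _ mt)// ler_pdivrMr ?exprn_gt0// -nE exprD mulrCA.
  by rewrite mulVf ?expf_neq0// mulr1 -natrX ler_nat ltnW.
apply/cvgryPge => A.
have pow_y : (2 / h `^ p) ^+ n @[n --> \oo] --> +oo.
  apply/gtr0_cvgV0; first by apply: nearW => n; rewrite exprn_gt0// divr_gt0.
  have z1 : `|(2 / h `^ p)^-1| < 1.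
    by rewrite gtr0_norm invf_div ?divr_gt0// ltr_pdivrMr// mul1r.
  apply: cvg_trans (cvg_expr z1); apply: near_eq_cvg.
  by apply: nearW => n; exact: exprVn.
have c0 : 0 < 2 ^- m * (r `^ p / 2) by rewrite mulr_gt0 ?invr_gt0 ?exprn_gt0 ?divr_gt0 ?powR_gt0.
near=> n; apply: le_trans (lower n _); last by near: n; exact: nbhs_infty_gt.
by rewrite -ler_pdivrMr//; near: n; move/cvgryPge : pow_y; exact.
Unshelve. all: by end_near. Qed.

(** At the critical exponent [h ^ p = 2], so the prefactor is exactly [2 ^- n], and
    [r ^ p = 2 / 2 ^ (1/H)] produces the constant [2 ^ (1 - 1/H)]. *)
Lemma dyadic_pvar_takagi_eq (c t : R) : 0 <= t <= 1 ->
  (forall u, sign_avg r (fun v => `|v| `^ H^-1) k (r ^+ k * u) @[k --> \oo] --> r `^ H^-1 * c) ->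
  dyadic_pvar x H^-1 t n @[n --> \oo] --> t * 2 `^ (1 - H^-1) * c.
Proof.
move=> t01 cvg_avg; have p0 : 0 < H^-1 by rewrite invr_gt0.
have rpE : r `^ H^-1 = 2 `^ (1 - H^-1).
  rewrite powRM ?(ltW h0)// hpE divff ?gt_eqF// powRB ?pnatr_eq0 ?implybT//.
  by rewrite -powR_inv1// -powRrM mulN1r powRN.
rewrite -mulrA -rpE (_ : dyadic_pvar x H^-1 t = fun n =>
    2 ^- n * \sum_(0 <= j < 2 ^ n | j%:R * 2 ^- n <= t) `|D n j| `^ H^-1); last first.
  by apply/funext => n; rewrite pvarE// hpE divff ?gt_eqF// powRr1.
apply: (@sign_tree_cvg R r D (fun v => `|v| `^ H^-1) ((r / (1 - r)) `^ H^-1) _ _ treeD) => //.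
  by move=> n j jn; exact: powR_D_bound.
Qed.

End TakagiVariation.

(** * The limit theorem and the continuous variation at [p = 1/H] *)

Theorem theorem2p1 (R : realType) (H : R) (x : R -> R)
    (d : measure_display) (T : measurableType d) (P : probability T R)
    (Y : nat -> {RV P >-> R})
    (H01 : 0 < H < 1) (xH : signed_takagi_landsberg H x)
    (iidY : iid_rademacher Y) :
  (forall p t : R, 0 < p -> 0 < t <= 1 ->
     (dyadic_pvar x p t n)%:E @[n --> \oo] -->
       (if (H^-1 < p)%R then 0
        else if (p < H^-1)%R then +oo
        else (t * 2 `^ (1 - H^-1))%:E *
             'E_P[fun w => (`|Z_sum H Y w| `^ p)%R])%E) /\
  (admits_continuous_pvariation x H^-1 /\
   forall t : R, 0 <= t <= 1 ->
     (pvariation x H^-1 t)%:E =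
       ((t * 2 `^ (1 - H^-1))%:E *
        'E_P[fun w => (`|Z_sum H Y w| `^ H^-1)%R])%E).
Proof.
case/andP: H01 => H0 H1; have p0 : 0 < H^-1 by rewrite invr_gt0.
have [c EZ cvg_avg] := sign_avg_powR_cvg iidY H H^-1 H1 p0.
have pvar_cvg t (t01 : 0 <= t <= 1) := dyadic_pvar_takagi_eq H0 H1 xH c t t01 cvg_avg.
have pvarE t : 0 <= t <= 1 -> pvariation x H^-1 t = t * 2 `^ (1 - H^-1) * c.
  by move=> t01; apply: cvg_lim => //; exact: pvar_cvg.
split; last split.
- move=> p t pp /andP[t0 t1]; have [Hp|pH|<-] := ltgtP H^-1 p.
  + by apply: cvg_EFin; [exact: nearW|exact: (dyadic_pvar_takagi_gt H0 H1 xH)].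
  + by apply/cvgeryP; exact: (dyadic_pvar_takagi_lt H0 xH).
  + rewrite EZ -EFinM; apply: cvg_EFin; first exact: nearW.
    by apply: pvar_cvg; rewrite (ltW t0).
- split=> [t t01|]; first by apply/cvg_ex; eexists; exact: pvar_cvg.
  (* The variation is identified with a linear function only on [[0, 1]], so continuity is
     transferred within that subspace. *)
  apply: (@subspace_eq_continuous _ _ _ (fun t : R => t * 2 `^ (1 - H^-1) * c)).
    by move=> t /set_mem; rewrite /= in_itv/= => /pvarE/esym.
  by apply: continuous_subspaceT => t; apply: cvgMl; apply: cvgMl; exact: cvg_id.
- by move=> t t01; rewrite EZ pvarE.
Qed.
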